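(* Let $\tau\ge 0$ and $\alpha\in\mathbb{R}$. There is a generic subset $\mathcal{G}$ of $\mathcal{S}^{II}_n$ such that, for every system $\sigma\in\mathcal{G}$, there is some $\widehat{\sigma}\in\mathcal{G}$ such that (1) $\sigma$ and $\widehat{\sigma}$ are i/o equivalent under all the pulses in the set $\mathcal{I}_{\tau,\alpha}$, but (2) $\sigma$ and $\widehat{\sigma}$ are not i/o equivalent.
   Context: A 4-tuple of dimension $n$ is $(A,N,b,c)$ with $A,N\in\mathbb{R}^{n\times n}$, $b\in\mathbb{R}^{n\times 1}$, $c\in\mathbb{R}^{1\times n}$. The bilinear system of type II associated with it is $\dot x=(A+uN)x$, $x(0)=b$, $y=cx$. The class $\mathcal{S}^{II}_n$ of all $n$-dimensional bilinear systems of type II is identified with $\mathbb{R}^{2n^2+2n}$ via 4-tuples. A subset of $\mathbb{R}^\ell$ is called generic if it is open and dense and its complement has Lebesgue measure zero. Inputs are Lebesgue-measurable, essentially bounded functions $u:[0,T_u]\to\mathbb{R}$; $\Omega$ is the set of all inputs. Two systems are i/o equivalent under a set $\mathcal{U}\subseteq\Omega$ of inputs if for each $u\in\mathcal{U}$ the two outputs $y(t)$ coincide for all $t\in[0,T_u]$; they are i/o equivalent (no qualifier) if this holds with $\mathcal{U}=\Omega$. For $\tau\ge0$ and $\alpha\in\mathbb{R}$, $\mathcal{I}_{\tau,\alpha}$ is the class of all functions (pulses) $\mathbf{u}_{\tau,\alpha,\beta}$, $\beta\in\mathbb{R}$ constant, with $\mathbf{u}_{\tau,\alpha,\beta}(t)=\alpha$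 for $0\le t<\tau$ and $\mathbf{u}_{\tau,\alpha,\beta}(t)=\beta$ for $t\ge\tau$. These may be viewed as defined on $[0,T]$ for any $T>\tau$; the choice of $T$ is immaterial, so equivalence under such an input means that outputs coincide for all $t\ge 0$.
   Formalization: The formal theorem assumes n ≥ 2. The claim fails for n = 1 (if cb ≠ 0, the pulse outputs determine cb, A and N, so equivalence under pulses implies i/o equivalence) and for n = 0 (all outputs are zero). *)

(* Defs.v *)
From HB Require Import structures.
From mathcomp Require Import all_boot all_order all_algebra.
From mathcomp Require Import all_classical all_reals all_analysis.

Set Implicit Arguments.
Unset Strict Implicit.
Unset Printing Implicit Defensive.

Import Order.TTheory GRing.Theory Num.Theory.
Import numFieldNormedType.Exports.

Local Open Scope classical_set_scope.
Local Open Scope ring_scope.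

(* The 4-tuple (A, N, b, c) stands for the bilinear system of type II
   x' = (A + u N) x, x(0) = b, y = c x. *)
Record bilinear_II (R : realType) (n : nat) := BilinearII {
  sysA : 'M[R]_n;
  sysN : 'M[R]_n;
  sysb : 'cV[R]_n;
  sysc : 'rV[R]_n }.

(* A bijection of n-dimensional systems with R^(2 n^2 + 2 n). *)
Definition coords (R : realType) (n : nat) (s : bilinear_II R n) :
    'rV[R]_((n * n + n * n) + (n + n)) :=
  row_mx (row_mx (mxvec (sysA s)) (mxvec (sysN s)))
         (row_mx (sysb s)^T (sysc s)).

Definition closed_box (R : realType) (l : nat) (p q : 'rV[R]_l) :
    set 'rV[R]_l :=
  [set x | forall j, p 0 j <= x 0 j <= q 0 j].

Definition box_cover (R : realType) (l : nat) (Z : set 'rV[R]_l)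
    (p q : nat -> 'rV[R]_l) : Prop :=
  (forall k j, p k 0 j <= q k 0 j) /\
  Z `<=` \bigcup_k closed_box (p k) (q k).

(* Lebesgue outer measure on R^l, for l > 0. Boxes may be degenerate, so
   finite covers are included as well. *)
Definition lebesgue_outer (R : realType) (l : nat) (Z : set 'rV[R]_l) :
    \bar R :=
  ereal_inf [set v | exists p q : nat -> 'rV[R]_l, box_cover Z p q /\
    v = (\sum_(0 <= k <oo) (\prod_(j < l) (q k 0 j - p k 0 j))%:E)%E].

Definition generic (R : realType) (l : nat) (G : set 'rV[R]_l) : Prop :=
  [/\ open G, dense G & lebesgue_outer (~` G) = 0%E].

(* A function [0, horizon] -> R; the values of [signal] outside this interval
   are never used. *)
Record input (R : realType) := Input {
  horizon : R;
  signal : R -> R }.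

(* Measurability is with respect to Lebesgue measurable (not only Borel) sets
   of the domain, i.e. the sigma-algebra carried by the domain of
   [completed_lebesgue_measure]. *)
Definition lebesgue_measurable_fun (R : realType) (D : set R) (u : R -> R) :
    Prop :=
  measurable_fun
    (D : set (caratheodory_type ((wlength (@idfun R))^*)%mu))
    (u : caratheodory_type ((wlength (@idfun R))^*)%mu -> measurableTypeR R).

Definition essentially_bounded (R : realType) (D : set R) (u : R -> R) :
    Prop :=
  exists M : R, \forall t \ae (@completed_lebesgue_measure R),
    D t -> `|u t| <= M.

Definition all_inputs (R : realType) : set (input R) :=
  [set w | [/\ 0 <= horizon w,
    lebesgue_measurable_fun `[0, horizon w] (signal w) &
    essentially_bounded `[0, horizon w] (signal w)]].

(* Caratheodory solution on [0, horizon] of x' = (A + u N) x, x(0) = b, in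
   integral form. For an input in [all_inputs] the integrand is integrable
   since x is continuous. *)
Definition trajectory (R : realType) (n : nat) (s : bilinear_II R n)
    (w : input R) (x : R -> 'cV[R]_n) : Prop :=
  {within `[0, horizon w], continuous x} /\
  forall t : R, 0 <= t <= horizon w -> forall i,
    x t i 0 = sysb s i 0 +
      \int[@completed_lebesgue_measure R]_(r in `[0, t])
        ((sysA s + signal w r *: sysN s) *m x r) i 0.

Definition output (R : realType) (n : nat) (s : bilinear_II R n)
    (x : R -> 'cV[R]_n) (t : R) : R :=
  (sysc s *m x t) 0 0.

(* Trajectories exist and are unique on [0, horizon], so quantifying over them
   amounts to naming the output of each system. *)
Definition io_equivalent_under (R : realType) (n m : nat) (U : set (input R))
    (s : bilinear_II R n) (s' : bilinear_II R m) : Prop :=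
  forall w, U w -> forall x x', trajectory s w x -> trajectory s' w x' ->
    forall t : R, 0 <= t <= horizon w -> output s x t = output s' x' t.

Definition io_equivalent (R : realType) (n m : nat)
    (s : bilinear_II R n) (s' : bilinear_II R m) : Prop :=
  io_equivalent_under (@all_inputs R) s s'.

Definition pulse (R : realType) (tau alpha beta t : R) : R :=
  if t < tau then alpha else beta.

(* Each pulse is taken on [0, T] for every T > tau, so that equivalence under
   this class means that outputs agree at all t >= 0. *)
Definition pulses (R : realType) (tau alpha : R) : set (input R) :=
  [set w | tau < horizon w /\
    exists beta : R, signal w = pulse tau alpha beta].

(* Main.v *)
Require Import Defs.
From mathcomp Require Import all_boot all_order all_algebra.
From mathcomp Require Import all_classical all_reals all_analysis.
From mathcomp Require Import measurable_realfun.
From mathcomp Require Import ring lra.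

(** Write [M = A + alpha N] and let [b' = exp (tau M) b] be the state at which
    every pulse switches. From then on a pulse is constant, so the output is
    the number [c exp (r (A + beta N)) b']. A number equals its own transpose:
    transposing [A] and [N] and exchanging the roles of [c] and [b'] leaves all
    these outputs unchanged. The companion of a system is therefore
    [transposed], which reads out along [b'] and starts from
    [exp (- tau M^T) c^T], so as to reach [c^T] at time [tau]. Before that time
    it outputs [c exp (- tau M) exp (t M) exp (tau M) b = c exp (t M) b], since
    exponentials of multiples of [M] commute ([io_equivalent_transposed]).

    Transposition reverses the order of the flows, and this becomes visible as
    soon as two different constants are applied in turn after time [tau]. If
    the two systems were equivalent, the flows of [A] and of [A + N], for any
    durations [h] and [k], could be exchanged between [c] and [b'];
    differentiating at [h = 0] and [k = 0] gives [c (A N - N A) b' = 0]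
    ([commuting_flows]). The generic set consists of the systems for which this
    number, [commutator_readout], is nonzero. It is stable under transposition,
    which only changes the sign of the number.

    That its complement is null and has a dense complement needs no analyticity
    of the exponential: one coordinate is peeled off at a time. A continuous
    function that is affine in one coordinate vanishes, where its slope does
    not, on a graph over the other coordinates, which is null, and it becomes
    nonzero after an arbitrarily small move ([thin_graph]). Now
    [c (A N - N A) b'] is affine in each [c_i], with slope
    [((A N - N A) b')_i]; this is affine in each [b_j], with slope
    [((A N - N A) exp (tau M))_ij]; this matrix vanishes only together with
    [A N - N A] because exponentials are invertible; an off-diagonal entry
    [(i, j)] of [A N - N A] is affine in [N_ii], with slope [- A_ij]; and [A_ij]
    is a coordinate ([thin_commutator_readout]).

    The link with the integral equation that defines trajectories is made for
    inputs that are constant on successive intervals: the integrands are then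
    Borel, the state follows a matrix exponential on each interval
    ([trajectory_const]), and gluing exponentials yields a trajectory
    ([trajectory_extend]). *)

Set Implicit Arguments.
Unset Strict Implicit.
Unset Printing Implicit Defensive.

Import Order.TTheory GRing.Theory Num.Theory.
Import numFieldNormedType.Exports.

Local Open Scope classical_set_scope.
Local Open Scope ring_scope.

(** * Null sets and exceptional sets *)

Definition box_volume (R : realType) (l : nat) (p q : 'rV[R]_l) : \bar R :=
  (\prod_(j < l) (q 0 j - p 0 j))%:E.

Lemma box_volume_ge0 (R : realType) (l : nat) (p q : 'rV[R]_l) :
  (forall j, p 0 j <= q 0 j) -> (0 <= box_volume p q)%E.
Proof.
by move=> pq; rewrite lee_fin; apply: prodr_ge0 => j _; rewrite subr_ge0.
Qed.

Lemma lebesgue_outer0P (R : realType) (l : nat) (Z : set 'rV[R]_l) :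
  lebesgue_outer Z = 0%E <->
  forall e : R, 0 < e -> exists p q : nat -> 'rV[R]_l, box_cover Z p q /\
    (\sum_(0 <= k <oo) box_volume (p k) (q k) <= e%:E)%E.
Proof.
split=> [Z0 e e0|Ze].
  have fZ : lebesgue_outer Z \is a fin_num by rewrite Z0.
  have [_ [p [q [cov ->]]] lt_e] := lb_ereal_inf_adherent e0 fZ.
  exists p, q; split=> //; apply: ltW.
  by move: lt_e; rewrite -/(lebesgue_outer Z) Z0 add0e.
apply/eqP; rewrite eq_le; apply/andP; split.
  apply/lee_addgt0Pr => e e0; rewrite add0e.
  have [p [q [cov le_e]]] := Ze e e0.
  apply: le_trans le_e; apply: ereal_inf_lbound; by exists p, q; split.
apply: le_ereal_inf_tmp => _ [p [q [[pq _] ->]]].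
by apply: nneseries_ge0 => k _ _; apply: box_volume_ge0.
Qed.

(** Covers indexed by any countable type are transported to [nat] along
    [pickle]; the unused indices receive a degenerate box, whose volume is [0]
    because [0 < l]. *)
Lemma countable_box_cover (R : realType) (l : nat) (I : countType)
    (Z : set 'rV[R]_l) (p q : I -> 'rV[R]_l) (e : \bar R) :
  (0 < l)%N -> (forall i j, p i 0 j <= q i 0 j) ->
  Z `<=` \bigcup_i closed_box (p i) (q i) ->
  (\esum_(i in [set: I]) box_volume (p i) (q i) <= e)%E ->
  exists p' q' : nat -> 'rV[R]_l, box_cover Z p' q' /\
    (\sum_(0 <= k <oo) box_volume (p' k) (q' k) <= e)%E.
Proof.
move=> l0 pq cov le_e.
pose p' k := oapp p 0 (@pickle_inv I k).
pose q' k := oapp q 0 (@pickle_inv I k).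
have pq' k j : p' k 0 j <= q' k 0 j.
  by rewrite /p' /q'; case: pickle_inv => [i|]//=.
exists p', q'; split.
  split=> // x /cov[i _ xi]; exists (pickle i) => //.
  by rewrite /p' /q' pickleK_inv.
rewrite nneseries_esumT; last by move=> k; apply: box_volume_ge0.
apply: le_trans le_e; rewrite le_eqVlt; apply/orP; left; apply/eqP.
pose a k := box_volume (p' k) (q' k).
have -> : \esum_(i in [set: I]) box_volume (p i) (q i) =
    \esum_(k in range (@pickle I)) a k.
  rewrite (reindex_esum [set: I] (range (@pickle I)) pickle a); last first.
    exact: (inj_bij (in2W (pcan_inj pickleK))).
  by apply: eq_esum => i _; rewrite /a /p' /q' pickleK_inv.
rewrite [RHS]esum_mkcond; apply: eq_esum => k _.
case: ifPn => // /negP kI; rewrite -/(a k) /a /p' /q'.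
case ik: (pickle_inv k) => [i|] /=.
  by case: kI; rewrite inE; exists i => //;
    have := @pickle_invK I k; rewrite ik.
by rewrite /box_volume (bigD1 (Ordinal l0))//= subrr mul0r.
Qed.

Lemma finite_box_cover (R : realType) (l : nat) (I : finType)
    (Z : set 'rV[R]_l) (p q : I -> 'rV[R]_l) (e : R) :
  (0 < l)%N -> (forall i j, p i 0 j <= q i 0 j) ->
  Z `<=` \bigcup_i closed_box (p i) (q i) ->
  \sum_i \prod_(j < l) (q i 0 j - p i 0 j) <= e ->
  exists p' q' : nat -> 'rV[R]_l, box_cover Z p' q' /\
    (\sum_(0 <= k <oo) box_volume (p' k) (q' k) <= e%:E)%E.
Proof.
move=> l0 pq cov le_e; apply: (countable_box_cover l0 pq cov).
rewrite esum_fset; first last.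
- by move=> i _; apply: box_volume_ge0.
- exact: finite_finset.
rewrite (_ : [set: I] = [set` index_enum I]); last first.
  by apply/seteqP; split=> // i _; rewrite /= mem_index_enum.
by rewrite -fsbig_seq ?index_enum_uniq// sumEFin lee_fin.
Qed.

Lemma null_subset (R : realType) (l : nat) (Y Z : set 'rV[R]_l) :
  Y `<=` Z -> lebesgue_outer Z = 0%E -> lebesgue_outer Y = 0%E.
Proof.
move=> YZ /lebesgue_outer0P Z0; apply/lebesgue_outer0P => e /Z0.
move=> [p [q [[pq cov] le_e]]]; exists p, q; do 2 split=> //.
exact: subset_trans cov.
Qed.

Lemma null_bigcup (R : realType) (l : nat) (Z : nat -> set 'rV[R]_l) :
  (0 < l)%N -> (forall k, lebesgue_outer (Z k) = 0%E) ->
  lebesgue_outer (\bigcup_k Z k) = 0%E.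
Proof.
move=> l0 Z0; apply/lebesgue_outer0P => e e0.
have cov k : exists pq : (nat -> 'rV[R]_l) * (nat -> 'rV[R]_l),
    box_cover (Z k) pq.1 pq.2 /\
    (\sum_(0 <= m <oo) box_volume (pq.1 m) (pq.2 m) <=
       (e / (2 ^ k.+1)%:R)%:E)%E.
  have /lebesgue_outer0P/(_ (e / (2 ^ k.+1)%:R)) := Z0 k.
  case=> [|p [q pq]]; last by exists (p, q).
  by rewrite divr_gt0// ltr0n expn_gt0.
have {cov}[f fP] := choice cov.
have vol_ge0 i k : (0 <= box_volume ((f i).1 k) ((f i).2 k))%E.
  by apply: box_volume_ge0; have [[+ _] _] := fP i; apply.
apply: (@countable_box_cover _ _ (nat * nat)%type _
  (fun i => (f i.1).1 i.2) (fun i => (f i.1).2 i.2)) => //.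
- by move=> [i k] j /=; have [[+ _] _] := fP i; apply.
- move=> x [i _ xZ]; have [[_ /(_ x xZ)[k _ xk]] _] := fP i.
  by exists (i, k).
rewrite (_ : [set: nat * nat] = [set: nat] `*`` (fun=> [set: nat])); last first.
  by apply/seteqP; split.
rewrite -(@esum_esum _ _ _ [set: nat] (fun=> [set: nat])
  (fun i k => box_volume ((f i).1 k) ((f i).2 k)))//.
rewrite -nneseries_esumT; last by move=> i; apply: esum_ge0.
apply: le_trans (epsilon_trick0 xpredT (ltW e0)).
apply: lee_nneseries => i _; first by move=> _; apply: esum_ge0.
by rewrite -nneseries_esumT//; have [_] := fP i.
Qed.

Lemma null_setU (R : realType) (l : nat) (Y Z : set 'rV[R]_l) : (0 < l)%N ->
  lebesgue_outer Y = 0%E -> lebesgue_outer Z = 0%E ->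
  lebesgue_outer (Y `|` Z) = 0%E.
Proof.
move=> l0 Y0 Z0; rewrite -bigcup2E; apply: null_bigcup => // -[|[|k]]//=.
exact: null_subset Y0.
Qed.

Lemma compact_unif_continuous (R : realType) (U V : normedModType R)
    (g : U -> V) (A : set U) : continuous g -> compact A ->
  forall e, 0 < e -> exists2 d, 0 < d &
    forall x y, A x -> `|x - y| < d -> `|g x - g y| < e.
Proof.
move=> gc /compact_near_coveringP cA e e0.
have : \forall d \near 0^'+, A `<=` [set x | forall y, `|x - y| < d ->
    `|g x - g y| < e].
  apply: cA => x _; have e20 : 0 < e / 2 by rewrite divr_gt0.
  have /cvgrPdist_lt/(_ _ e20)/nbhs_ballP[/= d d0 dP] := gc x.
  exists (ball x (d / 2), [set t : R | t < d / 2]) => /=.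
    split; first by apply: nbhsx_ballx; rewrite divr_gt0.
    by apply: nbhs_right_lt; rewrite divr_gt0.
  move=> [x' t] [/= xx' td] y x'y; rewrite -(subrK (g x) (g x')) -addrA.
  rewrite (le_lt_trans (ler_normD _ _))// (splitr e) ltrD//.
    rewrite distrC; apply: dP; apply: le_ball xx'.
    by move: d0; lra.
  apply: dP; rewrite -ball_normE/=; rewrite -ball_normE/= in xx'.
  rewrite -(subrK x' x) -addrA (le_lt_trans (ler_normD _ _))//.
  by rewrite (splitr d) ltrD// (lt_trans x'y).
move=> H; have [d [Hd d0]] := filter_ex (filterI H (nbhs_right_gt (0 : R))).
by exists d => // x y Ax; apply: Hd.
Qed.

(** Closed cells make every point of the segment, endpoints included, fall in
    some cell. *)
Lemma grid_cell (R : realType) (N : nat) (t : R) :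
  (0 < N)%N -> 0 <= t <= N%:R ->
  exists a : 'I_N, a%:R <= t <= a%:R + 1.
Proof.
elim: N => // -[|N] IHN _ /andP[t0 tN].
  by exists ord0; rewrite /= t0 add0r.
have [tN'|Nt] := leP t N.+1%:R.
  have [|a ta] := IHN isT; first by rewrite t0.
  by exists (widen_ord (leqnSn _) a).
by exists ord_max; rewrite /= (ltW Nt) natr1.
Qed.

Section graph_over_hyperplane.
Variables (R : realType) (l : nat) (i : 'I_l).
Implicit Types (g h : 'rV[R]_l -> R) (x : 'rV[R]_l).

(** Cut the other coordinates into cells so small that [g] varies by less than
    [eta * m] when they alone change within a cell. If [x] and [y] are zeros of
    [g] over the same cell, move [y] along direction [i] to the height of [x]:
    the value of [g] becomes [(x_i - y_i) h y] and is smaller than [eta * m], so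
    [x_i] and [y_i] differ by less than [eta]. One box of height [2 eta] per
    cell is thus enough, and the total volume is proportional to [eta]. *)
Lemma null_bounded_graph g h (K m : R) : continuous g ->
  (forall x t, g (x + t *: delta_mx 0 i) = g x + t * h x) ->
  0 < K -> 0 < m ->
  lebesgue_outer [set x | [/\ g x = 0, m <= `|h x| &
    forall j, - K <= x 0 j <= K]] = 0%E.
Proof.
move=> gc gi K0 m0; set Z := [set x | _].
have l0 : (0 < l)%N by case: l i => [[]|].
apply/lebesgue_outer0P => e e0.
pose P : R := \prod_(j < l | j != i) (2 * K).
have P0 : 0 <= P by apply: prodr_ge0 => j _; rewrite mulr_ge0// ltW.
pose eta := e / (2 * (P + 1)).
have eta0 : 0 < eta by rewrite divr_gt0// mulr_gt0// ltr_wpDl.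
have etaP : eta *+ 2 * P <= e.
  have : eta * (2 * (P + 1)) = e.
    by rewrite divfK// mulf_neq0// gt_eqF// ltr_wpDl.
  by move: eta0; rewrite -mulr_natr; lra.
have cA : compact [set x : 'rV[R]_l | forall j, x ord0 j \in `[-K, K]].
  apply: (@rV_compact _ _ (fun=> `[-K, K]%classic)) => _.
  exact: segment_compact.
have [d d0 dP] := compact_unif_continuous gc cA (mulr_gt0 eta0 m0).
have [N N0 NK] : exists2 N, (0 < N)%N & 2 * K / N%:R < d.
  exists (Num.truncn (2 * K / d)).+1 => //.
  rewrite ltr_pdivrMr ?ltr0n// (mulrC d) -ltr_pdivrMr//.
  exact: Num.Theory.truncnS_gt.
pose w : R := 2 * K / N%:R.
have w0 : 0 < w by rewrite !divr_gt0 ?mulr_gt0 ?ltr0n.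
have NwK : w * N%:R = 2 * K by rewrite divfK// pnatr_eq0 -lt0n.
pose lo (a : nat) : R := - K + w * a%:R.
pose cell (c : {ffun 'I_l -> 'I_N}) : set 'rV[R]_l :=
  [set x | forall j, j != i -> lo (c j) <= x 0 j <= lo (c j) + w].
pose z c := xget 0 (Z `&` cell c) : 'rV[R]_l.
(* All grid indices [c] are used, but only those with [c i] zero get a box of
   positive height: the total volume is then a full product of sums over the
   grid, which distributes over the coordinates. *)
pose I0 : 'I_N := Ordinal N0.
pose p (c : {ffun 'I_l -> 'I_N}) : 'rV[R]_l := \row_j
  if j == i then (if c i == I0 then z c 0 i - eta else 0) else lo (c j).
pose q (c : {ffun 'I_l -> 'I_N}) : 'rV[R]_l := \row_j
  if j == i then (if c i == I0 then z c 0 i + eta else 0) else lo (c j) + w.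
apply: (@finite_box_cover _ _ {ffun 'I_l -> 'I_N} _ p q) => //.
- move=> c j; rewrite !mxE; case: eqP => _; last by rewrite lerDl ltW.
  by case: eqP => // _; rewrite lerD2l; move: eta0; lra.
- move=> x Zx; have [gx hx xK] := Zx.
  have cx j : exists a : 'I_N, if j == i then a = I0 else
      lo a <= x 0 j <= lo a + w.
    case: eqP => _; first by exists I0.
    have [||a /andP[ax xa]] := @grid_cell _ N ((x 0 j + K) / w) => //.
      have /andP[xj1 xj2] := xK j.
      by rewrite divr_ge0/= ?ler_pdivrMr// ?(ltW w0) 1?mulrC ?NwK//; lra.
    exists a; rewrite /lo; move: ax xa.
    by rewrite ler_pdivlMr// ler_pdivrMr// mulrDl mul1r mulrC; lra.
  have [c cP] := choice cx; exists (finfun c) => // j.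
  have ci : c i = I0 by have := cP i; rewrite eqxx.
  have xc : cell (finfun c) x.
    by move=> k ki; have := cP k; rewrite (negbTE ki) ffunE.
  rewrite !mxE; case: eqP => [->|/eqP ji]; last exact: xc.
  rewrite ffunE ci eqxx.
  have [[gz hz zK] zc] : (Z `&` cell (finfun c)) (z (finfun c)).
    by apply: (xgetPex 0); exists x.
  set y := z _ in gz hz zK zc *.
  rewrite -ler_distl ltW// -(ltr_pM2r m0).
  (* [y'] lies over the same cell as [x], at the same height. *)
  pose y' := y + (x 0 i - y 0 i) *: delta_mx 0 i.
  have gy' : g y' = (x 0 i - y 0 i) * h y by rewrite /y' gi gz add0r.
  apply: (@le_lt_trans _ _ `|g x - g y'|).
    by rewrite gx sub0r normrN gy' normrM distrC ler_wpM2l.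
  apply: dP => [k|]; first by rewrite in_itv/=; apply: xK.
  apply: le_lt_trans NK; rewrite [leLHS]/Num.Def.normr/= mx_normrE.
  apply/bigmax_leP; split=> [|[k k'] _]/=; first exact: ltW.
  rewrite !mxE /= (ord1 k) eqxx /=.
  case: (eqVneq k' i) => [->|ki].
    by rewrite mulr1 (addrC (y 0 i)) subrK subrr normr0 ltW.
  rewrite mulr0 addr0.
  have := xc k' ki; have := zc k' ki; rewrite ler_norml -/w.
  by move=> /andP[? ?] /andP[? ?]; apply/andP; split; lra.
- pose F j (a : 'I_N) : R :=
    if j == i then (if a == I0 then eta *+ 2 else 0) else w.
  have -> : \sum_c \prod_(j < l) (q c 0 j - p c 0 j) =
      \sum_(c : {ffun 'I_l -> 'I_N}) \prod_(j < l) F j (c j).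
    apply: eq_bigr => c _; apply: eq_bigr => j _; rewrite !mxE /F.
    case: eqP => [->|_]; last by rewrite addrAC subrr add0r.
    by case: eqP => _; rewrite ?subrr// opprB addrA; ring.
  rewrite -bigA_distr_bigA (bigD1 i)//=.
  suff -> : (\sum_j F i j) * \prod_(j < l | j != i) \sum_a F j a =
    eta *+ 2 * P by [].
  congr (_ * _).
    by rewrite /F eqxx -big_mkcond big_pred1_eq.
  rewrite /P; apply: eq_bigr => j ji.
  rewrite /F (negbTE ji) sumr_const card_ord.
  by rewrite -[LHS]mulr_natr NwK.
Qed.

Lemma null_graph g h : continuous g ->
  (forall x t, g (x + t *: delta_mx 0 i) = g x + t * h x) ->
  lebesgue_outer [set x | g x = 0 /\ h x != 0] = 0%E.
Proof.
move=> gc gi; have l0 : (0 < l)%N by case: l i => [[]|].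
have k0 (k : nat) : 0 < k.+1%:R :> R by rewrite ltr0n.
have k1 (k : nat) : 0 < (k.+1%:R)^-1 :> R by rewrite invr_gt0.
apply: null_subset (null_bigcup l0 (fun k =>
  null_bounded_graph gc gi (k0 k) (k1 k))) => x [gx hx].
pose M := `|x| + `|h x|^-1.
have M0 : 0 <= M by rewrite addr_ge0// invr_ge0.
have MN : M < (Num.truncn M).+1%:R by exact: Num.Theory.truncnS_gt.
exists (Num.truncn M) => //; split=> //.
  rewrite -(invrK `|h x|) lef_pV2 ?posrE ?invr_gt0 ?normr_gt0//.
  by apply: ltW; apply: le_lt_trans MN; rewrite lerDr.
move=> j; rewrite -ler_norml; apply: ltW; apply: le_lt_trans MN.
apply: (@le_trans _ _ `|x|); last by rewrite lerDl invr_ge0.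
rewrite [leRHS]/Num.Def.normr/= mx_normrE; apply/bigmax_geP; right.
by exists (0, j).
Qed.

End graph_over_hyperplane.

(** Density of the complement is carried along with nullity instead of being
    deduced from it, which spares the computation of the outer measure of a
    box. *)
Definition thin (R : realType) (l : nat) (Z : set 'rV[R]_l) : Prop :=
  lebesgue_outer Z = 0%E /\ dense (~` Z).

Lemma thin_subset (R : realType) (l : nat) (Y Z : set 'rV[R]_l) :
  Y `<=` Z -> thin Z -> thin Y.
Proof.
move=> YZ [Z0 Zd]; split; first exact: null_subset Z0.
by move=> O O0 oO; have [x [Ox nZx]] := Zd O O0 oO; exists x; split=> // /YZ.
Qed.

Lemma thin_set0 (R : realType) (m : nat) : (0 < m)%N ->
  thin (set0 : set 'rV[R]_m).
Proof.
move=> m0; split; last first.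
  by move=> O O0 oO; rewrite setC0 setIT.
apply/lebesgue_outer0P => e e0.
apply: (@finite_box_cover _ _ unit _ (fun=> 0) (fun=> 0)) => //.
rewrite big1 ?ltW// => _ _; by rewrite (bigD1 (Ordinal m0))//= subrr mul0r.
Qed.

(** Off the common zeros of the slopes [h j], some [g j] is affine with nonzero
    slope along direction [dir j]: its zeros are null by [null_graph], and any
    small move in that direction leaves them. *)
Lemma thin_graph (R : realType) (l : nat) (J : countType)
    (g h : J -> 'rV[R]_l -> R) (dir : J -> 'I_l) : (0 < l)%N ->
  (forall j, continuous (g j)) ->
  (forall j x t, g j (x + t *: delta_mx 0 (dir j)) = g j x + t * h j x) ->
  thin [set x | forall j, h j x = 0] -> thin [set x | forall j, g j x = 0].
Proof.
move=> l0 gc gd [h0 hd]; split.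
  pose Z k := if @pickle_inv J k is Some j then
    [set x | g j x = 0 /\ h j x != 0] else set0.
  apply: null_subset (null_setU l0 h0 (null_bigcup (Z := Z) l0 _)).
    move=> x gx.
    have [hx|/existsNP[j /eqP hx]] := pselect (forall j, h j x = 0).
      by left.
    by right; exists (pickle j) => //=; rewrite /Z pickleK_inv.
  have null_j j := null_graph (gc j) (gd j).
  move=> k; rewrite /Z; case: pickle_inv => [j|]; first exact: null_j.
  exact: null_subset (fun x => False_ind _) h0.
move=> O O0 oO; have [x [Ox /existsNP[j /eqP hx]]] := hd O O0 oO.
have [gx|/eqP gx] := eqVneq (g j x) 0; last first.
  by exists x; split=> // /(_ j).
have : \forall t \near (0 : R)^', O (x + t *: delta_mx 0 (dir j)).
  apply: cvg_within.
  have : x + t *: delta_mx 0 (dir j) @[t --> (0 : R)] -->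
      x + 0 *: delta_mx 0 (dir j).
    by apply: cvgD; [exact: cvg_cst|apply: cvgZr_tmp; exact: cvg_id].
  by rewrite scale0r addr0; apply; exact: open_nbhs_nbhs.
move=> H; have [t [Ot t0]] := filter_ex (filterI H (nbhs_dnbhs_neq (0 : R))).
exists (x + t *: delta_mx 0 (dir j)); split=> // /(_ j).
by rewrite gd gx add0r; apply/eqP; rewrite mulf_neq0.
Qed.

(** * The matrix exponential *)

Lemma cvg_sumr (R : numFieldType) (T I : Type) (F : set_system T)
    (FF : Filter F) (r : seq I) (f : I -> T -> R) (a : I -> R) :
  (forall i, f i x @[x --> F] --> a i) ->
  \sum_(i <- r) f i x @[x --> F] --> \sum_(i <- r) a i.
Proof.
move=> fa; elim: r => [|i r IHr].
  by under eq_cvg do rewrite big_nil; rewrite big_nil; exact: cvg_cst.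
by under eq_cvg do rewrite big_cons; rewrite big_cons; exact: cvgD.
Qed.

Lemma is_derive1_sum (R : realType) (n : nat) (h : 'I_n -> R -> R) (t : R)
    (dh : 'I_n -> R) : (forall i, is_derive t 1 (h i) (dh i)) ->
  is_derive t 1 (fun s => \sum_i h i s) (\sum_i dh i).
Proof.
move=> dhP; rewrite (_ : (fun s => _) = \sum_i h i); first exact: is_derive_sum.
by apply/funext => s; rewrite fct_sumE.
Qed.

Section matrix_exponential.
Variables (R : realType) (n : nat).
Implicit Types (M : 'M[R]_n) (B t : R).

Definition expmx_coeff M (i j : 'I_n) : R^nat := fun k => (M ^+ k) i j / k`!%:R.

Definition expmx M t : 'M[R]_n :=
  \matrix_(i, j) limn (pseries (expmx_coeff M i j) t).

Lemma powmx_bound M B : (forall i j, `|M i j| <= B) ->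
  forall k i j, `|(M ^+ k) i j| <= (n%:R * B) ^+ k.
Proof.
move=> MB; elim=> [|k IHk] i j.
  by rewrite !expr0 mxE; case: (i == j); rewrite ?normr1 ?normr0.
rewrite !exprS -/(mulmx _ _) mxE.
apply: le_trans (ler_norm_sum _ _ _) _.
rewrite -mulrA mulr_natl -[X in _ *+ X]card_ord -sumr_const.
by apply: ler_sum => l _; rewrite normrM ler_pM.
Qed.

Lemma expmx_coeff_bound M B t : (forall i j, `|M i j| <= B) ->
  forall i j k, `|expmx_coeff M i j k * t ^+ k| <=
    exp_coeff (n%:R * B * `|t|) k.
Proof.
move=> MB i j k; rewrite /expmx_coeff /exp_coeff /= exprMn !normrM normrX.
rewrite mulrAC [X in _ * X <= _]ger0_norm ?invr_ge0//.
rewrite ler_wpM2r ?invr_ge0// ler_wpM2r ?exprn_ge0//.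
exact: powmx_bound.
Qed.

Lemma mx_entry_bounded M : exists B, forall i j, `|M i j| <= B.
Proof.
exists (\sum_i \sum_j `|M i j|) => i j.
rewrite (bigD1 i)//= (bigD1 j)//= -addrA lerDl addr_ge0//.
  exact: sumr_ge0.
by apply: sumr_ge0 => k _; exact: sumr_ge0.
Qed.

Lemma is_cvg_expmx M i j t : cvgn (pseries (expmx_coeff M i j) t).
Proof.
have [B MB] := mx_entry_bounded M.
apply: normed_cvg; apply: series_le_cvg (is_cvg_series_exp_coeff _) => //=.
- by move=> k; apply: le_trans (expmx_coeff_bound t MB i j k).
- exact: expmx_coeff_bound.
Qed.

(** Differentiating the series shifts it, so that the derivative of the
    exponential is multiplication by [M], on either side. *)
Lemma expmx_diffs_l M i j t :
  pseries (pseries_diffs (expmx_coeff M i j)) t =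
  fun m => \sum_(l < n) M i l * pseries (expmx_coeff M l j) t m.
Proof.
apply/funext => m; rewrite /pseries /series /=.
under [RHS]eq_bigr do rewrite mulr_sumr.
rewrite exchange_big /=; apply: eq_bigr => k _.
rewrite /pseries_diffs /expmx_coeff factS natrM invfM mulrCA.
rewrite mulVKf ?pnatr_eq0//.
rewrite exprS -/(mulmx _ _) mxE !mulr_suml; apply: eq_bigr => l _.
by rewrite !mulrA.
Qed.

Lemma expmx_diffs_r M i j t :
  pseries (pseries_diffs (expmx_coeff M i j)) t =
  fun m => \sum_(l < n) pseries (expmx_coeff M i l) t m * M l j.
Proof.
apply/funext => m; rewrite /pseries /series /=.
under [RHS]eq_bigr do rewrite mulr_suml.
rewrite exchange_big /=; apply: eq_bigr => k _.
rewrite /pseries_diffs /expmx_coeff factS natrM invfM mulrCA.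
rewrite mulVKf ?pnatr_eq0//.
rewrite exprSr -/(mulmx _ _) mxE !mulr_suml; apply: eq_bigr => l _.
by rewrite -!mulrA [M l j * _]mulrC -!mulrA.
Qed.

Lemma cvg_expmx_diffs M i j t :
  pseries (pseries_diffs (expmx_coeff M i j)) t @ \oo --> (M *m expmx M t) i j.
Proof.
rewrite expmx_diffs_l mxE; apply: cvg_sumr => l; rewrite mxE.
by apply: cvgMl_tmp; exact: is_cvg_expmx.
Qed.

Lemma expmxC M t : expmx M t *m M = M *m expmx M t.
Proof.
apply/matrixP => i j.
rewrite -(cvg_lim (@Rhausdorff R) (cvg_expmx_diffs (t := t))); apply/esym.
apply/cvg_lim => //; rewrite expmx_diffs_r mxE; apply: cvg_sumr => l.
by rewrite mxE; apply: cvgMr_tmp; exact: is_cvg_expmx.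
Qed.

Lemma is_derive_expmx M t i j :
  is_derive t 1 (fun s => expmx M s i j) ((M *m expmx M t) i j).
Proof.
rewrite (_ : (fun s => _) = fun s => limn (pseries (expmx_coeff M i j) s));
  last by apply/funext => s; rewrite mxE.
rewrite -(cvg_lim (@Rhausdorff R) (cvg_expmx_diffs (t := t))).
have cvgM s k l : cvgn (pseries (pseries_diffs (expmx_coeff M k l)) s).
  by apply/cvg_ex; eexists; exact: cvg_expmx_diffs.
apply: (@pseries_snd_diffs _ _ (`|t| + 1)) => //; first exact: is_cvg_expmx.
  rewrite [X in cvgn X](_ : _ = fun m => \sum_(l < n) M i l *
    pseries (pseries_diffs (expmx_coeff M l j)) (`|t| + 1) m).
    apply/cvg_ex; eexists; apply: cvg_sumr => l; apply: cvgMl_tmp; exact: cvgM.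
  apply/funext => m; rewrite /pseries /series /=.
  under [RHS]eq_bigr do rewrite mulr_sumr.
  rewrite exchange_big /=; apply: eq_bigr => k _.
  rewrite /pseries_diffs /expmx_coeff.
  rewrite exprS -/(mulmx _ _) mxE !(mulr_suml, mulr_sumr).
  apply: eq_bigr => l _; rewrite [in LHS]factS [in RHS]factS !natrM.
  have: k.+1%:R != 0 :> R by rewrite pnatr_eq0.
  have: k.+2%:R != 0 :> R by rewrite pnatr_eq0.
  have: k`!%:R != 0 :> R by rewrite pnatr_eq0 -lt0n fact_gt0.
  move: k.+1%:R k.+2%:R k`!%:R => x y z x0 y0 z0.
  by field; rewrite x0 y0 z0.
by rewrite [ltRHS]ger0_norm ?addr_ge0// ltrDl.
Qed.

Lemma expmx0 M : expmx M 0 = 1%:M.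
Proof.
apply/matrixP => i j; rewrite mxE; apply/cvg_lim => //.
rewrite -cvg_shiftS; apply: cvg_near_cst; near=> k => /=.
rewrite /pseries /series/= big_nat_recl//= big1 => [|l _].
  by rewrite addr0 /expmx_coeff !expr0 fact0 divr1 mulr1.
by rewrite exprS mul0r mulr0.
Unshelve. all: by end_near. Qed.

Lemma trmx_expmx M t : expmx M^T t = (expmx M t)^T.
Proof.
apply/matrixP => i j; rewrite !mxE; congr (limn (pseries _ t)).
apply/funext => k; rewrite /expmx_coeff; congr (_ / _).
have -> : M^T ^+ k = (M ^+ k)^T.
  elim: k => [|k IHk]; first by rewrite !expr0 trmx1.
  by rewrite exprS exprSr IHk; apply: esym; exact: trmx_mul.
by rewrite mxE.
Qed.

Lemma expmx_tail M B t N i j : (forall i j, `|M i j| <= B) ->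
  `|expmx M t i j - pseries (expmx_coeff M i j) t N| <=
    limn (series (exp_coeff (n%:R * B * `|t|))) -
    series (exp_coeff (n%:R * B * `|t|)) N.
Proof.
move=> MB; set v := exp_coeff _; set u := pseries _ t.
have cv : cvgn (series v) by exact: is_cvg_series_exp_coeff.
have cu : cvgn u by exact: is_cvg_expmx.
have v0 k : 0 <= v k by apply: le_trans (expmx_coeff_bound t MB i j k).
have uv m : (N <= m)%N -> `|u m - u N| <= series v m - series v N.
  move=> Nm; rewrite /u /pseries !sub_series_geq//.
  rewrite (le_trans (ler_norm_sum _ _ _))//.
  by apply: ler_sum => k _; exact: expmx_coeff_bound.
rewrite mxE -/u.
have cuN : `|u m - u N| @[m --> \oo] --> `|limn u - u N|.
  by apply: cvg_norm; apply: cvgB => //; exact: cvg_cst.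
rewrite -(cvg_lim (@Rhausdorff R) cuN); apply: limr_le.
  by apply/cvg_ex; eexists; exact: cuN.
near=> m; apply: le_trans (uv m _) _; first by near: m; exact: nbhs_infty_ge.
rewrite lerD2r; apply: nondecreasing_cvgn_le => //.
by apply/nondecreasing_series => k _ _.
Unshelve. all: by end_near. Qed.

(** The tails of the series are dominated by those of a scalar exponential as
    long as the entries stay bounded, hence the exponential is a locally uniform
    limit of polynomials in the entries. *)
Lemma continuous_expmx (T : topologicalType) (F : T -> 'M[R]_n) t :
  (forall i j, continuous (fun x => F x i j)) ->
  forall i j, continuous (fun x => expmx (F x) t i j).
Proof.
move=> Fc i j x0.
have [B0 FB0] := mx_entry_bounded (F x0); pose B := B0 + 1.
have FB : \forall x \near x0, forall i j, `|F x i j| <= B.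
  apply: filter_forall => k; apply: filter_forall => l.
  have /cvgrPdist_lt/(_ 1 ltr01) := Fc k l x0; apply: filterS => x xx0.
  rewrite -(subrK (F x0 k l) (F x k l)) (le_trans (ler_normD _ _))//.
  by rewrite addrC lerD// distrC ltW.
set v := exp_coeff (n%:R * B * `|t|).
have vc : cvgn (series v) by exact: is_cvg_series_exp_coeff.
apply/cvgrPdist_lt => e e0; have e3 : 0 < e / 3 by rewrite divr_gt0.
have [N vN] : exists N, limn (series v) - series v N < e / 3.
  have /cvgrPdist_lt/(_ _ e3)[N _ NP] := vc; exists N.
  by apply: le_lt_trans (ler_norm _) (NP N _); rewrite /= leqnn.
have powc k : forall a b, continuous (fun x => (F x ^+ k) a b).
  elim: k => [|k IHk] a b.
    by under eq_fun do rewrite expr0; exact: cst_continuous.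
  under eq_fun do rewrite exprS -/(mulmx _ _) mxE.
  move=> y; apply: cvg_sumr => l.
  by apply: cvgM; [exact: Fc|exact: IHk].
have pc : continuous (fun x => pseries (expmx_coeff (F x) i j) t N).
  move=> y; rewrite /pseries /series /=; apply: cvg_sumr => k.
  by apply: cvgMr_tmp; rewrite /expmx_coeff; apply: cvgMr_tmp; exact: powc.
have /cvgrPdist_lt/(_ _ e3) := pc x0.
apply: filterS2 (FB) => x FBx px.
have t0 := expmx_tail t N i j (nbhs_singleton FB).
have := expmx_tail t N i j FBx; rewrite distrC => t1.
rewrite -/v in t0 t1.
move: t0 t1 px; move: (expmx (F x0) t i j) (expmx (F x) t i j) => y0 y.
move: (pseries (expmx_coeff (F x0) i j) t N) => p0.
move: (pseries (expmx_coeff (F x) i j) t N) => p t0 t1 px.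
have -> : y0 - y = (y0 - p0) + (p0 - p) + (p - y) by ring.
have -> : e = (e / 3 + e / 3) + e / 3 by lra.
rewrite (le_lt_trans (ler_normD _ _))// ltrD//; last exact: le_lt_trans vN.
by rewrite (le_lt_trans (ler_normD _ _))// ltrD// (le_lt_trans t0).
Qed.

Lemma is_derive1_affine (a b t : R) : is_derive t 1 (fun s => a * s + b) a.
Proof.
have dc : is_derive t 1 (cst b : R -> R) 0 by exact: is_derive_cst.
have da : is_derive t 1 (a \*: (id : R -> R)) (a *: 1).
  by apply: is_deriveZ; exact: is_derive_id.
have -> : (fun s => a * s + b) = (a \*: (id : R -> R)) + cst b by [].
by apply: is_derive_eq (is_deriveD da dc) _;
  rewrite addr0 /GRing.scale /= mulr1.
Qed.

Lemma is_derive_expmx_affine M (k b t : R) i j :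
  is_derive t 1 (fun s => expmx M (k * s + b) i j)
    (k * (M *m expmx M (k * t + b)) i j).
Proof.
have := @is_derive1_comp _ (fun s => expmx M s i j) (fun s => k * s + b)
  t _ _ (is_derive_expmx _ _ _ _) (is_derive1_affine k b t).
by rewrite mulrC.
Qed.

(** [expmx M (a - t) *m x t] is constant along a solution of [x' = M x]. *)
Lemma linear_ode_uniq M (m : nat) (x : R -> 'M[R]_(n, m)) (a b : R) : a <= b ->
  (forall i j, {within `[a, b], continuous (fun t => x t i j)}) ->
  (forall t, t \in `]a, b[ -> forall i j,
    is_derive t 1 (fun s => x s i j) ((M *m x t) i j)) ->
  expmx M (a - b) *m x b = x a.
Proof.
rewrite le_eqVlt => /predU1P[-> _ _|ab xc dx].
  by rewrite subrr expmx0 mul1mx.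
apply/matrixP => i j.
pose y t := \sum_k expmx M (a - t) i k * x t k j.
have dE t k : is_derive t 1 (fun s => expmx M (a - s) i k)
    (- (expmx M (a - t) *m M) i k).
  have e s : a - s = -1 * s + a by rewrite mulN1r addrC.
  under eq_fun do rewrite e.
  by apply: is_derive_eq (is_derive_expmx_affine M (-1) a t i k) _;
    rewrite -e mulN1r expmxC.
have cy : {within `[a, b], continuous y}.
  move=> t; apply: cvg_sumr => k; apply: cvgM; last exact: xc.
  apply: derivable_within_continuous => s _; by have [] := dE s k.
have dy t : t \in `]a, b[ -> is_derive t 1 y 0.
  move=> tab.
  have d k : is_derive t 1 (fun s => expmx M (a - s) i k * x s k j)
      (expmx M (a - t) i k * (M *m x t) k j -
       (expmx M (a - t) *m M) i k * x t k j).
    apply: is_derive_eq (is_deriveM (dE t k) (dx t tab k j)) _.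
    by rewrite /GRing.scale /= mulrN [x t k j * _]mulrC.
  apply: is_derive_eq (is_derive1_sum d) _.
  rewrite sumrB; apply/eqP; rewrite subr_eq0; apply/eqP.
  have := congr1 (fun A : 'M[R]_(n, m) => A i j)
    (mulmxA (expmx M (a - t)) M (x t)).
  by rewrite !mxE.
have [c _] := MVT ab dy cy.
rewrite mul0r => /eqP; rewrite subr_eq0 mxE => /eqP; rewrite -/(y b) => ->.
transitivity ((expmx M (a - a) *m x a) i j); first by rewrite mxE.
by rewrite subrr expmx0 mul1mx.
Qed.

Lemma expmxNK M t : expmx M (- t) *m expmx M t = 1%:M.
Proof.
have pos s : 0 <= s -> expmx M (- s) *m expmx M s = 1%:M.
  move=> s0; have := @linear_ode_uniq M n (expmx M) 0 s s0.
  rewrite sub0r expmx0; apply=> [i j|r _ i j]; last exact: is_derive_expmx.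
  apply: derivable_within_continuous => r _.
  by have [] := is_derive_expmx M r i j.
have [/pos//|/ltW t0] := leP 0 t.
by apply: mulmx1C; rewrite -{1}(opprK t) pos// oppr_ge0.
Qed.

Lemma expmxKN M t : expmx M t *m expmx M (- t) = 1%:M.
Proof. by apply: mulmx1C; exact: expmxNK. Qed.

Lemma expmxD M s t : 0 <= t -> expmx M (s + t) = expmx M t *m expmx M s.
Proof.
move=> t0; pose x r := expmx M (1 * r + s).
have dx (r : R) i j : is_derive r 1 (fun r => x r i j) ((M *m x r) i j).
  by apply: is_derive_eq (is_derive_expmx_affine M 1 s r i j) _; rewrite mul1r.
have := @linear_ode_uniq M n x 0 t t0.
rewrite sub0r /x mulr0 add0r mul1r [t + s]addrC => <-.
- by rewrite mulmxA expmxKN mul1mx.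
- by move=> i j; apply: derivable_within_continuous => r _; have [] := dx r i j.
Qed.

End matrix_exponential.

(** * Integrals of piecewise continuous functions, and trajectories *)

(** The completed measure pushed forward along the identity map to the Borel
    line is the Lebesgue measure by definition, so both integrals agree, without
    any integrability assumption, as soon as the integrand is Borel. *)
Lemma integral_completed_lebesgue (R : realType) (D : set R) (f : R -> R) :
  measurable (D : set (measurableTypeR R)) ->
  measurable_fun (D : set (measurableTypeR R)) f ->
  \int[@completed_lebesgue_measure R]_(r in D) f r =
  \int[@lebesgue_measure R]_(r in D) f r.
Proof.
move=> mD mf; rewrite /Rintegral; congr fine.
pose phi : caratheodory_type ((wlength (@idfun R))^*)%mu -> measurableTypeR R :=
  id.
have mphi : measurable_fun setT phi.
  move=> _ B mB; rewrite setTI.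
  exact: (@sub_caratheodory _ _ _ (wlength (@idfun R))).
have pos (g : measurableTypeR R -> \bar R) :
    measurable_fun (D : set (measurableTypeR R)) g -> (forall r, 0 <= g r)%E ->
    (\int[@completed_lebesgue_measure R]_(r in D) g r =
     \int[@lebesgue_measure R]_(r in D) g r)%E.
  move=> mg g0; apply: esym.
  exact: (ge0_integral_pushforward mphi (@completed_lebesgue_measure R)).
have mEf : measurable_fun (D : set (measurableTypeR R)) (EFin \o f).
  exact/measurable_EFinP.
rewrite integralE [RHS]integralE; congr (_ - _)%E; apply: pos => //.
- exact: measurable_funepos.
- exact: measurable_funeneg.
Qed.

Section piecewise_continuous_integral.
Variable R : realType.
Notation leb := (@lebesgue_measure R).
Implicit Types (a b c : R) (f g : R -> R).

(** The values at the two endpoints are left free: this is what allows a signal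
    to jump there. *)
Lemma integrable_oo_continuous f g a b :
  {within `[a, b], continuous g} -> {in `]a, b[, f =1 g} ->
  leb.-integrable `[a, b] (EFin \o f).
Proof.
move=> gc fg.
have /integrableP[mg ig] : leb.-integrable `[a, b] (EFin \o g).
  by apply: continuous_compact_integrable => //; exact: segment_compact.
have mf : measurable_fun (`]a, b[ : set (measurableTypeR R)) f.
  apply: (eq_measurable_fun g) => [r|]; first by rewrite inE => /fg.
  have /measurable_EFinP := mg; apply: measurable_funS => //.
  exact: subset_itv_oo_cc.
have mf' : measurable_fun (`[a, b] : set (measurableTypeR R)) f.
  exact/measurable_fun_itv_obnd_cbndP/measurable_fun_itv_bndo_bndcP.
apply/integrableP; split; first exact/measurable_EFinP.
apply: le_lt_trans ig.
have mn (h : R -> R) : measurable_fun (`]a, b[ : set (measurableTypeR R)) h ->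
    measurable_fun (`]a, b[ : set (measurableTypeR R)) (fun r => `|(h r)%:E|%E).
  by move=> mh; do 2 apply: measurableT_comp => //.
rewrite integral_itv_bndoo; last exact: mn.
rewrite [leRHS]integral_itv_bndoo; last first.
  apply: mn; have /measurable_EFinP := mg; apply: measurable_funS => //.
  exact: subset_itv_oo_cc.
rewrite le_eqVlt; apply/orP; left; apply/eqP; apply: eq_integral => r.
by rewrite inE /= => /fg ->.
Qed.

Lemma eq_Rintegral_oo f g a b : leb.-integrable `[a, b] (EFin \o f) ->
  leb.-integrable `[a, b] (EFin \o g) -> {in `]a, b[, f =1 g} ->
  \int[leb]_(r in `[a, b]) f r = \int[leb]_(r in `[a, b]) g r.
Proof.
have moo h : leb.-integrable `[a, b] (EFin \o h) ->
    measurable_fun (`]a, b[ : set (measurableTypeR R)) (EFin \o h).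
  move=> /integrableP[+ _]; apply: measurable_funS => //.
  exact: subset_itv_oo_cc.
move=> /moo mf /moo mg fg; rewrite /Rintegral.
rewrite integral_itv_bndoo// [in RHS]integral_itv_bndoo//.
by congr fine; apply: eq_integral => r; rewrite inE /= => /fg ->.
Qed.

Lemma integrable_itv_cat f a b c : a <= b <= c ->
  leb.-integrable `[a, b] (EFin \o f) -> leb.-integrable `[b, c] (EFin \o f) ->
  leb.-integrable `[a, c] (EFin \o f).
Proof.
move=> /andP[ab bc] fab fbc.
have {fbc}fbc : leb.-integrable `]b, c] (EFin \o f).
  by apply: integrableS fbc => //; exact: subset_itv_oc_cc.
have -> : `[a, c]%classic = `[a, b]%classic `|` `]b, c]%classic.
  by apply: itv_bndbnd_setU; rewrite bnd_simp.
move: fab fbc => /integrableP[m1 i1] /integrableP[m2 i2].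
have mU : measurable_fun
    (`[a, b]%classic `|` `]b, c]%classic : set (measurableTypeR R)) (EFin \o f).
  exact/measurable_funU.
apply/integrableP; split => //.
rewrite ge0_integral_setU//=; first exact: lte_add_pinfty.
  exact: (measurableT_comp (@abse_measurable R setT) mU).
apply/disj_setPS => r [/=]; rewrite !in_itv/= => /andP[_ rb] /andP[].
by rewrite ltNge rb.
Qed.

End piecewise_continuous_integral.

Lemma Rintegral_derive (R : realType) (F f : R -> R) (a b : R) : a < b ->
  (forall t : R, is_derive t 1 F (f t)) -> {within `[a, b], continuous f} ->
  \int[@lebesgue_measure R]_(r in `[a, b]) f r = F b - F a.
Proof.
move=> ab dF fc; rewrite /Rintegral (@continuous_FTC2 _ f F)//.
  have Fc r : F x @[x --> r] --> F r.
    apply: differentiable_continuous; apply/derivable1_diffP.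
    by have [] := dF r.
  split=> [r _||]; first by have [] := dF r.
    exact: cvg_at_right_filter.
  exact: cvg_at_left_filter.
by move=> r _; rewrite derive1E; have [_ ->] := dF r.
Qed.

Lemma cvg_colE (R : realType) (n : nat) (T : Type) (F : set_system T)
    (FF : Filter F) (f : T -> 'cV[R]_n) (v : 'cV[R]_n) :
  (forall i, f t i 0 @[t --> F] --> v i 0) -> f t @[t --> F] --> v.
Proof.
move=> fv; apply/cvg_ballP => e e0.
have : \forall t \near F, forall i, ball (v i 0) e (f t i 0).
  by apply: filter_forall => i; have /cvg_ballP/(_ e e0) := fv i.
apply: filterS => t tv; split=> // i j; rewrite (ord1 j); exact: tv.
Qed.

Lemma is_derive_expmx_mul (R : realType) (n : nat) (M : 'M[R]_n) (v : 'cV[R]_n)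
    (a t : R) i :
  is_derive t 1 (fun r => (expmx M (r - a) *m v) i 0)
    ((M *m (expmx M (t - a) *m v)) i 0).
Proof.
have e (r : R) : r - a = 1 * r + - a by rewrite mul1r.
have -> : (fun r => (expmx M (r - a) *m v) i 0) =
    fun r => \sum_k expmx M (1 * r + - a) i k * v k 0.
  by apply/funext => r; rewrite mxE e.
have d k : is_derive t 1 (fun r => expmx M (1 * r + - a) i k * v k 0)
    ((M *m expmx M (1 * t + - a)) i k * v k 0).
  have dc : is_derive t 1 (cst (v k 0) : R -> R) 0 by exact: is_derive_cst.
  apply: is_derive_eq
    (is_deriveM (is_derive_expmx_affine M 1 (- a) t i k) dc) _.
  by rewrite scaler0 add0r mul1r /GRing.scale/= mulrC.
apply: is_derive_eq (is_derive1_sum d) _.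
by rewrite mulmxA [RHS]mxE e.
Qed.

Section trajectories.
Variables (R : realType) (n : nat) (s : bilinear_II R n).
Notation leb := (@lebesgue_measure R).
Implicit Types (w : input R) (x : R -> 'cV[R]_n) (a b t beta : R).

Definition velocity w x (i : 'I_n) (r : R) : R :=
  ((sysA s + signal w r *: sysN s) *m x r) i 0.

Definition generator beta : 'M[R]_n := sysA s + beta *: sysN s.

Lemma trajectory_continuous w x : trajectory s w x -> forall i,
  {within `[0, horizon w], continuous (fun r => x r i 0)}.
Proof.
move=> [xc _] i t; apply: (@cvg_comp _ _ _ x (fun v : 'cV[R]_n => v i 0)).
  exact: xc.
exact: coord_continuous.
Qed.

Lemma continuous_mulmx (D : set R) (M : 'M[R]_n) x :
  (forall i, {within D, continuous (fun r => x r i 0)}) ->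
  forall i, {within D, continuous (fun r => (M *m x r) i 0)}.
Proof.
move=> xc i.
have -> : (fun r => (M *m x r) i 0) = fun r => \sum_k M i k * x r k 0.
  by apply/funext => r; rewrite mxE.
by move=> t; apply: cvg_sumr => k; apply: cvgMl_tmp; exact: xc.
Qed.

Lemma trajectory_increment w x a b :
  trajectory s w x -> 0 <= a <= b -> b <= horizon w ->
  (forall i, leb.-integrable `[0, b] (EFin \o velocity w x i)) ->
  forall i, x b i 0 = x a i 0 + \int[leb]_(r in `[a, b]) velocity w x i r.
Proof.
move=> [_ xE] /andP[a0 ab] bT Fb i.
have mF t : t <= b -> leb.-integrable `[0, t] (EFin \o velocity w x i).
  move=> tb; apply: integrableS (Fb i) => //.
  by apply: subset_itvl; rewrite bnd_simp.
have xE' t : 0 <= t <= b -> x t i 0 =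
    sysb s i 0 + \int[leb]_(r in `[0, t]) velocity w x i r.
  move=> /andP[t0 tb]; rewrite xE ?t0 ?(le_trans tb)//; congr (_ + _).
  apply: integral_completed_lebesgue => //.
  by have /integrableP[/measurable_EFinP] := mF t tb.
rewrite (xE' b) ?(xE' a) ?a0 ?ab ?(le_trans a0 ab) ?lexx//.
rewrite -addrA; congr (_ + _).
rewrite -Rintegral_itv_obnd_cbnd.
  rewrite -(Rintegral_itvB (Fb i)) ?bnd_simp//; ring.
by apply: integrableS (Fb i) => //; apply: subset_itv; rewrite bnd_simp.
Qed.

(** Integrability of the velocity on [[0, a]] is required because the defining
    integrals start at [0], and it is returned on [[0, b]] so that the lemma can
    be applied to one interval after the other. *)
Lemma trajectory_const w x beta a b :
  trajectory s w x -> 0 <= a <= b -> b <= horizon w ->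
  (forall i, leb.-integrable `[0, a] (EFin \o velocity w x i)) ->
  {in `]a, b[, signal w =1 cst beta} ->
  x b = expmx (generator beta) (b - a) *m x a /\
  (forall i, leb.-integrable `[0, b] (EFin \o velocity w x i)).
Proof.
move=> trx /andP[a0 ab] bT Fa wb.
have xc i : {within `[a, b], continuous (fun r => x r i 0)}.
  have := @trajectory_continuous w x trx i; apply: continuous_subspaceW.
  by apply: subset_itv; rewrite bnd_simp.
pose M := generator beta; pose G i r := (M *m x r) i 0.
have Gc i : {within `[a, b], continuous (G i)} by exact: continuous_mulmx.
have FG i : {in `]a, b[, velocity w x i =1 G i}.
  by move=> r rab; rewrite /velocity wb.
have Fab i := integrable_oo_continuous (Gc i) (FG i).
have Fb i : leb.-integrable `[0, b] (EFin \o velocity w x i).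
  by apply: (integrable_itv_cat (b := a)) => //; rewrite a0.
split=> //.
suff : expmx M (a - b) *m x b = x a.
  by move=> <-; rewrite mulmxA -(opprB a b) expmxNK mul1mx.
apply: linear_ode_uniq => // [i j|t tab i j].
  by rewrite (ord1 j); exact: xc.
rewrite (ord1 j) => {j}.
have /andP[ta tb] : a < t < b by move: tab; rewrite in_itv.
have GI : leb.-integrable `[a, b] (EFin \o G i).
  by apply: continuous_compact_integrable => //; exact: segment_compact.
have Gt : {for t, continuous (G i)}.
  exact: within_continuous_continuous (lt_trans ta tb) (Gc i) tab.
have [dG G't] := continuous_FTC1_closed tb GI ta Gt.
have inc r : a <= r <= b -> x r i 0 = x a i 0 + \int[leb]_(q in `[a, r]) G i q.
  move=> /andP[ar rb].
  rewrite (trajectory_increment trx (a := a)) ?a0 ?(le_trans rb)//; last first.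
    move=> k; apply: integrableS (Fb k) => //.
    by apply: subset_itvl; rewrite bnd_simp.
  have sub_ab : `[a, r] `<=` `[a, b] by apply: subset_itv; rewrite bnd_simp.
  congr (_ + _); apply: eq_Rintegral_oo.
  - by apply: integrableS (Fab i) => //.
  - by apply: integrableS GI => //.
  - move=> q qar; apply: FG; move: qar; rewrite !in_itv/= => /andP[-> qr].
    exact: lt_le_trans qr rb.
apply: (@near_eq_is_derive _ _ _
  (cst (x a i 0) + fun r => \int[leb]_(q in `[a, r]) G i q)).
  near=> r; apply/esym; apply: inc; apply/andP; split; apply: ltW; near: r.
    exact: lt_nbhsr.
  exact: lt_nbhsl.
apply: is_derive_eq (is_deriveD (is_derive_cst _ _ _) _) _; last exact: add0r.
by apply: DeriveDef dG _; rewrite -derive1E G't.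
Unshelve. all: by end_near. Qed.

(** The old signal is kept at the time [horizon w] itself, so that the old
    velocity is unchanged on a closed interval. *)
Definition extend_input w beta h : input R :=
  Input (horizon w + h)
    (fun r => if r <= horizon w then signal w r else beta).

Definition extend_state w x beta (r : R) : 'cV[R]_n :=
  if r <= horizon w then x r
  else expmx (generator beta) (r - horizon w) *m x (horizon w).

(** Up to time [horizon w] nothing changes; afterwards the exponential is the
    integral of its own derivative. *)
Lemma trajectory_extend w x beta h : 0 <= horizon w -> 0 <= h ->
  trajectory s w x ->
  (forall i, leb.-integrable `[0, horizon w] (EFin \o velocity w x i)) ->
  trajectory s (extend_input w beta h) (extend_state w x beta) /\
  (forall i, leb.-integrable `[0, horizon w + h]
     (EFin \o velocity (extend_input w beta h) (extend_state w x beta) i)).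
Proof.
move=> T0 h0 trx Fi; set w' := extend_input _ _ _; set x' := extend_state _ _ _.
set T := horizon w in T0 Fi *; pose M := generator beta.
pose y r : 'cV[R]_n := expmx M (r - T) *m x T.
have yT : y T = x T by rewrite /y subrr expmx0 mul1mx.
have x'_lt r : r <= T -> x' r = x r by rewrite /x' /extend_state -/T => ->.
have x'_gt r : T <= r -> x' r = y r.
  rewrite le_eqVlt => /predU1P[<-|Tr]; first by rewrite x'_lt// yT.
  by rewrite /x' /extend_state -/T leNgt Tr.
have dy i t : is_derive t 1 (fun r => y r i 0) ((M *m y t) i 0).
  exact: is_derive_expmx_mul.
have yc i D : {within D, continuous (fun r => y r i 0)}.
  apply: continuous_subspaceT => r; apply: differentiable_continuous.
  by apply/derivable1_diffP; have [] := dy i r.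
have Gc i D : {within D, continuous (fun r => (M *m y r) i 0)}.
  exact: continuous_mulmx.
have F'old i : {in `[0, T], velocity w' x' i =1 velocity w x i}.
  move=> r; rewrite in_itv/= => /andP[_ rT].
  by rewrite /velocity /w' /extend_input/= -/T rT x'_lt.
have F'new i t : {in `]T, t[, velocity w' x' i =1 fun r => (M *m y r) i 0}.
  move=> r; rewrite in_itv/= => /andP[Tr _].
  by rewrite /velocity /w' /extend_input/= -/T leNgt Tr /= x'_gt ?ltW.
have F'T i : leb.-integrable `[0, T] (EFin \o velocity w' x' i).
  apply: eq_integrable (Fi i) => // r; rewrite inE /= => /F'old F'r.
  by rewrite F'r.
have F'tail i t : leb.-integrable `[T, t] (EFin \o velocity w' x' i).
  exact: integrable_oo_continuous (Gc i _) (F'new i t).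
have F't i t : T <= t -> leb.-integrable `[0, t] (EFin \o velocity w' x' i).
  by move=> Tt; apply: (integrable_itv_cat (b := T)) => //; rewrite T0.
split; last by move=> i; apply: F't; rewrite lerDl.
split.
  rewrite (_ : `[0, horizon w']%classic = `[0, T] `|` `[T, T + h]); last first.
    apply/seteqP; split=> r /=; rewrite !in_itv/=.
      move=> /andP[r0 rh]; have [rT|/ltW Tr] := leP r T; [left|right];
      exact/andP.
    move=> [/andP[r0 rT]|/andP[Tr rh]]; apply/andP; split=> //.
      by rewrite (le_trans rT)// lerDl.
    exact: le_trans Tr.
  apply: withinU_continuous; [exact: interval_closed|exact: interval_closed| |].
    apply: (subspace_eq_continuous (f := x)) => [r|]; last exact: trx.1.
    by rewrite inE /= in_itv/= => /andP[_ /x'_lt].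
  apply: (subspace_eq_continuous (f := y)) => [r|].
    by rewrite inE /= in_itv/= => /andP[/x'_gt].
  by move=> r; apply: cvg_colE => i; exact: yc.
move=> t /andP[t0 tTh] i; rewrite -/(velocity w' x' i _).
have old r : 0 <= r <= T -> x r i 0 = sysb s i 0 +
    \int[@completed_lebesgue_measure R]_(q in `[0, r]) velocity w' x' i q.
  move=> /andP[r0 rT]; rewrite trx.2 ?r0//; congr (_ + _).
  apply: eq_Rintegral => q; rewrite inE/= in_itv/= => /andP[q0 qr].
  by apply/esym/F'old; rewrite in_itv/= q0 (le_trans qr).
have [tT|Tt] := leP t T; first by rewrite x'_lt// old ?t0.
have cleb r : r <= t ->
    \int[@completed_lebesgue_measure R]_(q in `[0, r]) velocity w' x' i q =
    \int[leb]_(q in `[0, r]) velocity w' x' i q.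
  move=> rt; apply: integral_completed_lebesgue => //.
  have /integrableP[/measurable_EFinP + _] := F't i t (ltW Tt).
  by apply: measurable_funS => //; apply: subset_itvl; rewrite bnd_simp.
have -> : x' t i 0 = x T i 0 + (y t i 0 - y T i 0).
  by rewrite yT (x'_gt t (ltW Tt)); ring.
rewrite old ?T0 ?lexx// -addrA; congr (_ + _).
rewrite -(Rintegral_derive Tt (dy i) (Gc i _)) !cleb// ?(ltW Tt)//.
rewrite -(eq_Rintegral_oo (F'tail i t) _ (F'new i t)); last first.
  by apply: continuous_compact_integrable => //; exact: segment_compact.
rewrite -Rintegral_itv_obnd_cbnd; last first.
  by apply: integrableS (F'tail i t) => //; exact: subset_itv_oc_cc.
by rewrite -(Rintegral_itvB (F't i t (ltW Tt))) ?bnd_simp ?(ltW Tt)//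
  addrC subrK.
Qed.

End trajectories.

(** * The transposed system *)

Section transposed_system.
Variables (R : realType) (n : nat) (tau alpha : R).
Implicit Types s : bilinear_II R n.

Definition pulse_generator s : 'M[R]_n := generator s alpha.

Definition pulse_state s : 'cV[R]_n := expmx (pulse_generator s) tau *m sysb s.

(** The initial state is chosen so that the state at time [tau], under the
    constant input [alpha], is the transpose of [sysc s]. *)
Definition transposed s : bilinear_II R n :=
  BilinearII (sysA s)^T (sysN s)^T
    (expmx (pulse_generator s)^T (- tau) *m (sysc s)^T) (pulse_state s)^T.

Definition commutator_readout s : R :=
  (sysc s *m (sysA s *m sysN s - sysN s *m sysA s) *m pulse_state s) 0 0.

Lemma generator_transposed s beta :
  generator (transposed s) beta = (generator s beta)^T.
Proof. by rewrite /generator /= linearD linearZ. Qed.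

Lemma pulse_state_transposed s : pulse_state (transposed s) = (sysc s)^T.
Proof.
rewrite /pulse_state /pulse_generator generator_transposed /= mulmxA expmxKN.
exact: mul1mx.
Qed.

Lemma trmx11 (A : 'M[R]_1) : A^T = A.
Proof. by apply/matrixP => i j; rewrite mxE (ord1 i) (ord1 j). Qed.

Lemma commutator_readout_transposed s :
  commutator_readout (transposed s) = - commutator_readout s.
Proof.
rewrite /commutator_readout pulse_state_transposed /= -!trmx_mul -linearB.
rewrite -!trmx_mul trmx11 -mulmxA -[sysN s *m _ - _]opprB mulNmx mulmxN mxE.
by rewrite mulmxA.
Qed.

Lemma integrable_velocity0 s (w : input R) x i :
  (@lebesgue_measure R).-integrable `[0, 0] (EFin \o velocity s w x i).
Proof.
apply: (@integrable_oo_continuous R _ (cst 0)).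
  by apply: continuous_subspaceT => r; exact: cst_continuous.
by move=> r; rewrite in_itv/= => /andP[r0 /(lt_trans r0)]; rewrite ltxx.
Qed.

Lemma trajectory_start s (w : input R) x : 0 <= horizon w ->
  trajectory s w x -> x 0 = sysb s.
Proof.
move=> T0 trx; apply/colP => i; rewrite trx.2 ?lexx//.
rewrite -[RHS]addr0; congr (_ + _).
rewrite (@integral_completed_lebesgue R `[0, 0] (velocity s w x i))//.
  by rewrite set_itv1 Rintegral_set1.
by have /integrableP[/measurable_EFinP] := integrable_velocity0 s w x i.
Qed.

Lemma pulse_trajectory s (w : input R) beta x t : 0 <= tau -> tau < horizon w ->
  signal w = pulse tau alpha beta -> trajectory s w x -> 0 <= t <= horizon w ->
  x t = if t <= tau then expmx (pulse_generator s) t *m sysb s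
        else expmx (generator s beta) (t - tau) *m pulse_state s.
Proof.
move=> tau0 tauT wE trx /andP[t0 tT].
have x0 := trajectory_start (le_trans tau0 (ltW tauT)) trx.
have phase1 r : 0 <= r <= tau -> x r = expmx (pulse_generator s) r *m sysb s /\
    (forall i, (@lebesgue_measure R).-integrable `[0, r]
      (EFin \o velocity s w x i)).
  move=> /andP[r0 rtau].
  have [||||xr Fr] := @trajectory_const R n s w x alpha 0 r trx.
  - by rewrite lexx.
  - by rewrite (le_trans rtau)// ltW.
  - exact: integrable_velocity0.
  - move=> q; rewrite in_itv/= wE => /andP[_ qr].
    by rewrite /pulse (lt_le_trans qr).
  by rewrite xr subr0 x0.
have [ttau|taut] := leP t tau; first by have [] := phase1 t; rewrite ?t0.
have [|xtau Ftau] := phase1 tau; first by rewrite tau0 lexx.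
have [||||-> _] := @trajectory_const R n s w x beta tau t trx => //.
- by rewrite tau0 ltW.
- move=> q; rewrite in_itv/= wE => /andP[tq _].
  by rewrite /pulse ltNge (ltW tq).
by rewrite xtau.
Qed.

(** After time [tau] both outputs are transposes of one another; before it they
    agree because the flows for the durations [- tau], [t] and [tau] commute. *)
Lemma io_equivalent_transposed s : 0 <= tau ->
  io_equivalent_under (pulses tau alpha) s (transposed s).
Proof.
move=> tau0 w [tauT [beta wE]] x x' trx trx' t tT.
rewrite /output (pulse_trajectory tau0 tauT wE trx tT).
rewrite (pulse_trajectory tau0 tauT wE trx' tT) generator_transposed.
rewrite pulse_state_transposed /pulse_generator generator_transposed.
rewrite !trmx_expmx /=.
case: ifP => _; last first.
  by rewrite -!trmx_mul trmx11 mulmxA.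
rewrite /pulse_generator trmx_expmx -!trmx_mul trmx11.
rewrite /pulse_state /pulse_generator.
have /andP[t0 _] := tT.
set M := generator s alpha.
(* All flows of [M] commute. *)
have Et : expmx M t = expmx M (- tau) *m expmx M t *m expmx M tau.
  rewrite -mulmxA -expmxD// addrC expmxD// mulmxA expmxNK.
  by rewrite mul1mx.
by rewrite {1}Et !mulmxA.
Qed.

End transposed_system.

Section step_inputs.
Variables (R : realType) (n : nat).
Implicit Types (s : bilinear_II R n) (p : seq (R * R)).

(** An entry [(beta, h)] of the list asks for the value [beta] during a time
    [h], starting where the preceding entries stop. *)
Definition staircase p : input R :=
  foldl (fun w q => extend_input w q.1 q.2) (Input 0 (cst 0)) p.

Definition flow s p : 'cV[R]_n :=
  foldl (fun v q => expmx (generator s q.1) q.2 *m v) (sysb s) p.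

Lemma horizon_staircase_ge0 p :
  all (fun q => 0 <= q.2) p -> 0 <= horizon (staircase p).
Proof.
elim/last_ind: p => [|p q IHp]; first by [].
rewrite all_rcons => /andP[q0 /IHp p0].
by rewrite /staircase foldl_rcons /= addr_ge0.
Qed.

Lemma staircase_input p : all (fun q => 0 <= q.2) p -> all_inputs (staircase p).
Proof.
move=> p0.
have [mw [K wK]] : measurable_fun (setT : set (measurableTypeR R))
      (signal (staircase p)) /\
    exists K, forall r, `|signal (staircase p) r| <= K.
  elim/last_ind: p p0 => [_|p q IHp].
    by split; [exact: measurable_cst|exists 0 => r; rewrite normr0].
  rewrite all_rcons => /andP[q0 /IHp[mw [K wK]]].
  rewrite /staircase foldl_rcons -/(staircase p) /=; split.
    apply: measurable_fun_ifT => //.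
    apply: measurable_fun_ler; [exact: measurable_id|exact: measurable_cst].
  exists (Num.max K `|q.1|) => r; rewrite le_max.
  by case: ifP => _; rewrite ?wK ?lexx ?orbT.
split; first exact: horizon_staircase_ge0.
  move=> _ B mB; have := mw measurableT B mB; rewrite setTI => mBw.
  apply: measurableI.
    exact: (@sub_caratheodory _ _ _ (wlength (@idfun R)) _
      (measurable_itv `[0, horizon (staircase p)])).
  exact: (@sub_caratheodory _ _ _ (wlength (@idfun R))).
by exists K; apply: aeW => r _.
Qed.

Lemma staircase_trajectory s p : all (fun q => 0 <= q.2) p ->
  exists2 x, trajectory s (staircase p) x &
    x (horizon (staircase p)) = flow s p.
Proof.
move=> p0.
suff [x [trx xp _]] : exists x, [/\ trajectory s (staircase p) x,
    x (horizon (staircase p)) = flow s p &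
    forall i, (@lebesgue_measure R).-integrable `[0, horizon (staircase p)]
      (EFin \o velocity s (staircase p) x i)] by exists x.
elim/last_ind: p p0 => [_|p q IHp].
  exists (cst (sysb s)); split=> //=; last first.
    by move=> i; exact: integrable_velocity0.
  split=> [|t /=].
    by apply: continuous_subspaceT => r; exact: cst_continuous.
  rewrite -eq_le => /eqP <- i.
  rewrite (@integral_completed_lebesgue R `[0, 0]
    (velocity s (Input 0 (cst 0)) (cst (sysb s)) i))//.
    by rewrite set_itv1 Rintegral_set1 addr0.
  by have /integrableP[/measurable_EFinP] :=
    integrable_velocity0 s (Input 0 (cst 0)) (cst (sysb s)) i.
rewrite all_rcons => /andP[q0 p0]; have [x [trx xp Fx]] := IHp p0.
have T0 := horizon_staircase_ge0 p0.
have [trx' Fx'] := trajectory_extend q.1 T0 q0 trx Fx.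
exists (extend_state s (staircase p) x q.1).
rewrite /staircase /flow !foldl_rcons -/(staircase p) -/(flow s p); split=> //.
rewrite /extend_state /= gerDl; case: leP => [q0'|_].
  have -> : q.2 = 0 by apply/eqP; rewrite eq_le q0' q0.
  by rewrite addr0 expmx0 mul1mx.
by rewrite addrC addKr xp.
Qed.

End step_inputs.

Section nonequivalence.
Variables (R : realType) (n : nat).

(** Durations are nonnegative, so that flows can only be compared on one side
    of [0]. *)
Lemma right_derivative_eq (f g : R -> R) (a b : R) :
  is_derive (0 : R) 1 f a -> is_derive (0 : R) 1 g b ->
  (forall h, 0 <= h -> f h = g h) -> a = b.
Proof.
move=> df dg fg; have [dk k'] := is_deriveB df dg.
have : h^-1 *: ((f - g) (h *: 1 + 0) - (f - g) 0) @[h --> 0^'] --> a - b.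
  by rewrite -k'; exact: dk.
move=> /cvg_dnbhs_at_right k0.
have k1 : h^-1 *: ((f - g) (h *: 1 + 0) - (f - g) 0)
    @[h --> (0 : R)^'+] --> (0 : R).
  apply: cvg_near_cst; near=> h.
  have h0 : 0 <= h by apply: ltW; near: h; exact: nbhs_right_gt.
  rewrite !fctE addr0 /GRing.scale /= mulr1 (fg h h0) (fg 0 (lexx 0)).
  by rewrite !subrr mulr0.
by apply/eqP; rewrite -subr_eq0; apply/eqP; apply: cvg_unique k0 k1.
Unshelve. all: by end_near. Qed.

Lemma is_derive0_expmx (M : 'M[R]_n) (u : 'rV[R]_n) (v : 'cV[R]_n) :
  is_derive (0 : R) 1 (fun h => (u *m expmx M h *m v) 0 0) ((u *m M *m v) 0 0).
Proof.
have d k : is_derive (0 : R) 1 (fun h => u 0 k * (expmx M (h - 0) *m v) k 0)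
    (u 0 k * (M *m v) k 0).
  have := is_derive_expmx_mul M v 0 0 k; rewrite subrr expmx0 mul1mx => dk.
  by have := is_deriveZ (u 0 k) dk.
have -> : (fun h => (u *m expmx M h *m v) 0 0) =
    fun h => \sum_k u 0 k * (expmx M (h - 0) *m v) k 0.
  by apply/funext => h; rewrite subr0 -mulmxA mxE.
by apply: is_derive_eq (is_derive1_sum d) _; rewrite -mulmxA [RHS]mxE.
Qed.

(** The mixed derivative at [h = k = 0], taken one variable at a time. *)
Lemma commuting_flows (A B : 'M[R]_n) (u : 'rV[R]_n) (v : 'cV[R]_n) :
  (forall h k, 0 <= h -> 0 <= k ->
    (u *m expmx B k *m expmx A h *m v) 0 0 =
    (u *m expmx A h *m expmx B k *m v) 0 0) ->
  (u *m (B *m A) *m v) 0 0 = (u *m (A *m B) *m v) 0 0.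
Proof.
move=> AB; rewrite !mulmxA -[_ *m A *m v]mulmxA.
apply: (right_derivative_eq (is_derive0_expmx B u (A *m v))
  (is_derive0_expmx B (u *m A) v)) => k k0.
rewrite mulmxA.
apply: (right_derivative_eq (is_derive0_expmx A (u *m expmx B k) v) _)
  => [|h h0].
  have := is_derive0_expmx A u (expmx B k *m v).
  rewrite [u *m A *m _]mulmxA; exact.
by rewrite AB// -!mulmxA.
Qed.

(** The inputs that separate the systems hold [alpha] for [tau], then [0] for
    [h], then [1] for [k]: the last two values select the flows of [A] and of
    [A + N], whose commutator is that of [A] and [N]. *)
Lemma not_io_equivalent_transposed (tau alpha : R) (s : bilinear_II R n) :
  0 <= tau -> commutator_readout tau alpha s != 0 ->
  ~ io_equivalent s (transposed tau alpha s).
Proof.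
move=> tau0 /eqP cs eqv; apply: cs.
have swap h k : 0 <= h -> 0 <= k ->
    (sysc s *m expmx (generator s 1) k *m expmx (generator s 0) h *m
       pulse_state tau alpha s) 0 0 =
    (sysc s *m expmx (generator s 0) h *m expmx (generator s 1) k *m
       pulse_state tau alpha s) 0 0.
  move=> h0 k0; pose p := [:: (alpha, tau); (0, h); (1, k)].
  have p0 : all (fun q : R * R => 0 <= q.2) p by rewrite /= tau0 h0 k0.
  have [x trx xp] := staircase_trajectory s p0.
  have [x' trx' xp'] := staircase_trajectory (transposed tau alpha s) p0.
  have := eqv _ (staircase_input p0) _ _ trx trx' _.
  move=> /(_ (horizon (staircase p))); rewrite horizon_staircase_ge0// lexx.
  move=> /(_ isT); rewrite /output xp xp' /flow /=.
  rewrite -[expmx _ tau *m sysb s]/(pulse_state tau alpha s) !mulmxA => ->.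
  have := pulse_state_transposed tau alpha s.
  rewrite /pulse_state /pulse_generator /= -!mulmxA => ->.
  rewrite !generator_transposed !trmx_expmx -!trmx_mul trmx11.
  by rewrite !mulmxA.
have := commuting_flows swap.
rewrite /generator scale0r addr0 scale1r mulmxDl !mulmxDr !mulmxDl.
rewrite [LHS]mxE [RHS]mxE => /addrI NA_AN.
rewrite /commutator_readout mulmxBr mulmxBl [LHS]mxE [X in _ + X]mxE NA_AN.
by rewrite subrr.
Qed.

End nonequivalence.

(** * Genericity *)

Section mx_continuity.
Variables (R : realType) (T : topologicalType).

Lemma continuous_mulmx_entries (m n p : nat) (F : T -> 'M[R]_(m, n))
    (G : T -> 'M[R]_(n, p)) :
  (forall i j, continuous (fun x => F x i j)) ->
  (forall i j, continuous (fun x => G x i j)) ->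
  forall i j, continuous (fun x => (F x *m G x) i j).
Proof.
move=> Fc Gc i j; under eq_fun do rewrite mxE.
by move=> x; apply: cvg_sumr => k; apply: cvgM; [exact: Fc|exact: Gc].
Qed.

Lemma continuous_addmx_entries (m n : nat) (F G : T -> 'M[R]_(m, n)) (a : R) :
  (forall i j, continuous (fun x => F x i j)) ->
  (forall i j, continuous (fun x => G x i j)) ->
  forall i j, continuous (fun x => (F x + a *: G x) i j).
Proof.
move=> Fc Gc i j; under eq_fun do rewrite !mxE.
by move=> x; apply: cvgD; [exact: Fc|apply: cvgMl_tmp; exact: Gc].
Qed.

End mx_continuity.

Section system_coordinates.
Variables (R : realType) (n : nat).
Notation l := ((n * n + n * n) + (n + n))%N.
Implicit Types (s : bilinear_II R n) (x : 'rV[R]_l).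

Definition of_coords x : bilinear_II R n :=
  BilinearII (vec_mx (lsubmx (lsubmx x))) (vec_mx (rsubmx (lsubmx x)))
    (lsubmx (rsubmx x))^T (rsubmx (rsubmx x)).

Lemma coordsK : cancel (@coords R n) of_coords.
Proof.
move=> [A N b c]; rewrite /of_coords /coords /=.
by rewrite !(row_mxKl, row_mxKr) !mxvecK trmxK.
Qed.

Lemma of_coordsK : cancel of_coords (@coords R n).
Proof. by move=> x; rewrite /coords /= !vec_mxK trmxK !hsubmxK. Qed.

Lemma image_coordsE (G : set (bilinear_II R n)) :
  @coords R n @` G = [set x | G (of_coords x)].
Proof.
apply/seteqP; split=> [_ [s Gs <-]|x Gx] /=; first by rewrite coordsK.
by exists (of_coords x) => //; rewrite of_coordsK.
Qed.

Definition dirA i j : 'I_l := lshift (n + n) (lshift (n * n) (mxvec_index i j)).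
Definition dirN i j : 'I_l := lshift (n + n) (rshift (n * n) (mxvec_index i j)).
Definition dirb (i : 'I_n) : 'I_l := rshift (n * n + n * n) (lshift n i).
Definition dirc (i : 'I_n) : 'I_l := rshift (n * n + n * n) (rshift n i).

Lemma sysA_of_coords x i j : sysA (of_coords x) i j = x 0 (dirA i j).
Proof. by rewrite !mxE. Qed.

Lemma sysN_of_coords x i j : sysN (of_coords x) i j = x 0 (dirN i j).
Proof. by rewrite !mxE. Qed.

Lemma sysb_of_coords x i j : sysb (of_coords x) i j = x 0 (dirb i).
Proof. by rewrite (ord1 j) !mxE. Qed.

Lemma sysc_of_coords x i j : sysc (of_coords x) i j = x 0 (dirc j).
Proof. by rewrite (ord1 i) !mxE. Qed.

Lemma of_coordsDA x t i j : of_coords (x + t *: delta_mx 0 (dirA i j)) =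
  let s := of_coords x in
  BilinearII (sysA s + t *: delta_mx i j) (sysN s) (sysb s) (sysc s).
Proof.
rewrite /of_coords !delta_mx_lshift -mxvec_delta /= !linearD !linearZ /=.
by rewrite !(row_mxKl, row_mxKr) !linear0 mxvecK ?scaler0 !addr0.
Qed.

Lemma of_coordsDN x t i j : of_coords (x + t *: delta_mx 0 (dirN i j)) =
  let s := of_coords x in
  BilinearII (sysA s) (sysN s + t *: delta_mx i j) (sysb s) (sysc s).
Proof.
rewrite /of_coords delta_mx_lshift delta_mx_rshift -mxvec_delta /=.
rewrite !linearD !linearZ /=.
by rewrite !(row_mxKl, row_mxKr) !linear0 mxvecK ?scaler0 !addr0.
Qed.

Lemma of_coordsDb x t i : of_coords (x + t *: delta_mx 0 (dirb i)) =
  let s := of_coords x in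
  BilinearII (sysA s) (sysN s) (sysb s + t *: delta_mx i 0) (sysc s).
Proof.
rewrite /of_coords delta_mx_rshift delta_mx_lshift /= !linearD !linearZ /=.
by rewrite !(row_mxKl, row_mxKr) !linear0 trmx_delta ?scaler0 !addr0.
Qed.

Lemma of_coordsDc x t i : of_coords (x + t *: delta_mx 0 (dirc i)) =
  let s := of_coords x in
  BilinearII (sysA s) (sysN s) (sysb s) (sysc s + t *: delta_mx 0 i).
Proof.
rewrite /of_coords !delta_mx_rshift /= !linearD !linearZ /=.
by rewrite !(row_mxKl, row_mxKr) !linear0 ?scaler0 !addr0.
Qed.

End system_coordinates.

Section generic_systems.
Variables (R : realType) (n : nat) (tau alpha : R).
Notation l := ((n * n + n * n) + (n + n))%N.
Implicit Types x : 'rV[R]_l.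

Let A x := sysA (of_coords x).
Let N x := sysN (of_coords x).
Let b x := sysb (of_coords x).
Let c x := sysc (of_coords x).
Let K x := A x *m N x - N x *m A x.
Let E x := expmx (pulse_generator alpha (of_coords x)) tau.

Let contA i j : continuous (fun x => A x i j).
Proof.
by under eq_fun do rewrite /A sysA_of_coords; exact: coord_continuous.
Qed.

Let contN i j : continuous (fun x => N x i j).
Proof.
by under eq_fun do rewrite /N sysN_of_coords; exact: coord_continuous.
Qed.

Let contb i j : continuous (fun x => b x i j).
Proof.
by under eq_fun do rewrite /b sysb_of_coords; exact: coord_continuous.
Qed.

Let contc i j : continuous (fun x => c x i j).
Proof.
by under eq_fun do rewrite /c sysc_of_coords; exact: coord_continuous.
Qed.

Let contK i j : continuous (fun x => K x i j).
Proof.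
rewrite (_ : (fun x => _) = fun x => (A x *m N x + (-1) *: (N x *m A x)) i j).
  by apply: continuous_addmx_entries; apply: continuous_mulmx_entries.
by apply/funext => x; rewrite /K scaleN1r.
Qed.

Let contE i j : continuous (fun x => E x i j).
Proof. exact/continuous_expmx/continuous_addmx_entries. Qed.

Let contKE i j : continuous (fun x => (K x *m E x) i j).
Proof. exact: continuous_mulmx_entries. Qed.

Let contKEb i j : continuous (fun x => (K x *m E x *m b x) i j).
Proof. exact: continuous_mulmx_entries. Qed.

Lemma commutator_readoutE x :
  commutator_readout tau alpha (of_coords x) = (c x *m (K x *m E x *m b x)) 0 0.
Proof. by rewrite /commutator_readout /pulse_state !mulmxA. Qed.

Lemma continuous_commutator_readout :
  continuous (fun x => commutator_readout tau alpha (of_coords x)).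
Proof.
by under eq_fun do rewrite commutator_readoutE; exact: continuous_mulmx_entries.
Qed.

(** The chain of affine dependences runs through an entry [A i0 i1] with
    [i0 != i1]: perturbing [N i0 i0] moves the same entry of the commutator by
    [- A i0 i1], which requires two distinct indices. *)
Lemma thin_commutator_readout : (2 <= n)%N ->
  thin [set x : 'rV[R]_l | commutator_readout tau alpha (of_coords x) = 0].
Proof.
move=> n2; have n0 : (0 < n)%N by exact: leq_trans n2.
pose i0 : 'I_n := Ordinal n0; pose i1 : 'I_n := Ordinal n2.
have l0 : (0 < l)%N by rewrite !addn_gt0 n0 !orbT.
have thinA : thin [set x | A x i0 i1 = 0].
  apply: (thin_subset (Z := [set x | unit -> A x i0 i1 = 0])) => [x Ax _ //|].
  apply: (@thin_graph R l unit (fun _ x => A x i0 i1) (fun _ _ => 1)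
    (fun=> dirA i0 i1)) => // [_ x t|].
    by rewrite /A of_coordsDA /= !mxE !eqxx.
  apply: thin_subset (thin_set0 R l0) => x /(_ tt)/eqP.
  by rewrite oner_eq0.
have thinK : thin [set x | K x i0 i1 = 0].
  apply: (thin_subset (Z := [set x | unit -> K x i0 i1 = 0])) => [x Kx _ //|].
  apply: (@thin_graph R l unit (fun _ x => K x i0 i1) (fun _ x => - A x i0 i1)
    (fun=> dirN i0 i0)) => // [_ x t|].
    rewrite /K /A /N of_coordsDN /= mulmxDr mulmxDl -scalemxAr -scalemxAl.
    rewrite opprD addrACA -scalerBr [LHS]mxE; congr (_ + _).
    rewrite [LHS]mxE; congr (_ * _); rewrite [LHS]mxE [X in X + _]mxE.
    rewrite big1 ?add0r => [|k _]; last by rewrite [X in _ * X]mxE andbF mulr0.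
    rewrite [LHS]mxE; congr (- _).
    rewrite [LHS]mxE (bigD1 i0)//= big1 => [|k k0].
      by rewrite [X in X * _]mxE !eqxx mul1r addr0.
    by rewrite [X in X * _]mxE (negbTE k0) andbF mul0r.
  apply: thin_subset thinA => x /(_ tt)/eqP.
  by rewrite oppr_eq0 => /eqP.
have thinKE : thin [set x |
    forall ij : 'I_n * 'I_n, (K x *m E x) ij.1 ij.2 = 0].
  apply: thin_subset thinK => x KE0.
  have KE : K x *m E x = 0 by apply/matrixP => i j; rewrite (KE0 (i, j)) mxE.
  rewrite /= -[K x]mulmx1 -(expmxKN (pulse_generator alpha (of_coords x)) tau).
  by rewrite mulmxA KE mul0mx mxE.
have thinKEb : thin [set x |
    forall ij : 'I_n * 'I_n, (K x *m E x *m b x) ij.1 0 = 0].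
  apply: (thin_graph (dir := fun ij => dirb ij.2) l0 _ _ thinKE) => [ij|ij x t].
    exact: contKEb.
  rewrite /K /E /pulse_generator /generator /A /N /b of_coordsDb /=.
  rewrite mulmxDr -scalemxAr.
  rewrite [LHS]mxE [X in _ + X]mxE; congr (_ + _ * _).
  by rewrite -colE mxE.
apply: (thin_subset (Z := [set x : 'rV[R]_l |
    forall i : 'I_n, commutator_readout tau alpha (of_coords x) = 0])) =>
  [x rx _ //|].
apply: (thin_graph (dir := fun i => dirc i)
  (h := fun i x => (K x *m E x *m b x) i 0) l0).
- by move=> _; exact: continuous_commutator_readout.
- move=> i x t; rewrite !commutator_readoutE.
  have -> : c (x + t *: delta_mx 0 (dirc i)) = c x + t *: delta_mx 0 i.
    by rewrite /c of_coordsDc.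
  have -> : K (x + t *: delta_mx 0 (dirc i)) = K x.
    by rewrite /K /A /N of_coordsDc.
  have -> : E (x + t *: delta_mx 0 (dirc i)) = E x.
    by rewrite /E /pulse_generator /generator of_coordsDc.
  have -> : b (x + t *: delta_mx 0 (dirc i)) = b x by rewrite /b of_coordsDc.
  rewrite mulmxDl -scalemxAl.
  rewrite [LHS]mxE [X in _ + X]mxE; congr (_ + _ * _).
  by rewrite -rowE mxE.
- apply: thin_subset thinKEb => x KEb [i j]; exact: KEb.
Qed.

End generic_systems.

Theorem theorem2 (R : realType) (n : nat) (hn : (2 <= n)%N)
    (tau alpha : R) (htau : 0 <= tau) :
  exists G : set (bilinear_II R n),
    generic (@coords R n @` G) /\
    forall s, G s -> exists s', [/\ G s',
      io_equivalent_under (pulses tau alpha) s s' &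
      ~ io_equivalent s s'].
Proof.
exists [set s | commutator_readout tau alpha s != 0]; split; last first.
  move=> s /= cs; exists (transposed tau alpha s); split.
  - by rewrite /= commutator_readout_transposed oppr_eq0.
  - exact: io_equivalent_transposed.
  - exact: not_io_equivalent_transposed.
pose r x := commutator_readout tau alpha (@of_coords R n x).
have [Z0 Zd] := @thin_commutator_readout R n tau alpha hn.
have compl : @coords R n @` [set s | commutator_readout tau alpha s != 0] =
    ~` [set x | r x = 0].
  by rewrite image_coordsE; apply/seteqP; split=> x /= /eqP.
rewrite compl; split; rewrite ?setCK//; apply: closed_openC.
have rc : continuous r by exact: continuous_commutator_readout.
exact: (closed_comp (fun x _ => rc x) (@closed_eq R 0)).
Qed.
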